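(* Let $m\ge 1$, $n\ge 0$ and $\ell\ge 1$ be integers, and let $x_1,\ldots,x_m\in\mathbb{C}$. Let $V=(x_j^k)_{1\le j\le m,\,0\le k\le n}$ be the $m\times(n+1)$ Vandermonde matrix and, for $1\le i\le \ell$, let $V_{(i)}$ be the $i$th order derivative matrix corresponding to $V$. Let $X=\mathrm{diag}(x_1,\ldots,x_m)$, let $I$ and $O$ be the $m\times m$ identity and zero matrices, and let $\mathbf{e}=(1,\ldots,1)^T\in\mathbb{C}^m$ and $\mathbf{0}\in\mathbb{C}^m$ the zero vector. Then for every $0\le k\le n$, the $(k+1)$th column of the stacked matrix \[ \begin{pmatrix} V\\ V_{(1)}\\ V_{(2)}\\ \vdots\\ V_{(\ell)}\end{pmatrix}\in\mathbb{C}^{(\ell+1)m\times(n+1)} \] is exactly equal to \[ \begin{pmatrix} X & O & \cdots & \cdots & O \\ I & X & \ddots & & \vdots\\ O & 2I & \ddots & \ddots & \vdots\\ \vdots & \ddots & \ddots & \ddots & O\\ O & \cdots & O & \ell I & X \end{pmatrix}^{k} \begin{pmatrix}\mathbf{e}\\ \mathbf{0}\\ \vdots\\ \mathbf{0}\\ \mathbf{0}\end{pmatrix}, \] where the block matrix is the $(\ell+1)m\times(\ell+1)m$ block lower bidiagonal matrix, with block rows and columns indexed $0,1,\ldots,\ell$, whose diagonal blocks all equal $X$, whose block in position $(i,i-1)$ is $iI$ for $1\le i\le\ell$, and whose other blocks are $O$.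
   Context: Columns are numbered starting from $1$, so the $(k+1)$th column of $V$ is $(x_1^k,\ldots,x_m^k)^T$, corresponding to the monomial $x^k$. The $i$th order derivative matrix $V_{(i)}$ is the $m\times(n+1)$ matrix whose entry in row $j$ and column $k+1$ (for $0\le k\le n$) is the $i$th derivative of the monomial $x^k$ evaluated at $x_j$, i.e. $k(k-1)\cdots(k-i+1)\,x_j^{k-i}$ if $k\ge i$, and $0$ if $k<i$. The convention $x^0=1$ (also at $x=0$) and $A^0=$ identity matrix is used. *)

(* Defs.v *)
From HB Require Import structures.
From mathcomp Require Import all_boot all_order all_algebra.
From mathcomp Require Import reals complex.

Set Implicit Arguments.
Unset Strict Implicit.
Unset Printing Implicit Defensive.

Import GRing.Theory.
Local Open Scope ring_scope.

(* The library's [Vandermonde] has one column per point and one row per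
   monomial, i.e. it is the transpose of the matrix (x_j ^ k)_(j, k). *)
Definition vandermonde (C : comNzRingType) (m n : nat) (x : 'rV[C]_m) :
  'M[C]_(m, n.+1) := (Vandermonde n.+1 x)^T.

Definition deriv_vandermonde (C : comNzRingType) (m n : nat) (x : 'rV[C]_m)
    (i : nat) : 'M[C]_(m, n.+1) :=
  \matrix_(j < m, k < n.+1) (('X^k)^`(i)).[x 0 j].

(* The falling factorial [k ^_ i] = k (k - 1) ... (k - i + 1) vanishes for
   k < i, so the truncation in [k - i] is harmless. *)
Lemma deriv_vandermondeE (C : comNzRingType) (m n : nat) (x : 'rV[C]_m)
    (i : nat) (j : 'I_m) (k : 'I_n.+1) :
  deriv_vandermonde n x i j k = (k ^_ i)%:R * x 0 j ^+ (k - i).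
Proof. by rewrite mxE derivnXn hornerMn hornerXn mulr_natl. Qed.

Definition stacked_vandermonde (C : comNzRingType) (m n l : nat)
    (x : 'rV[C]_m) : 'M[C]_(\sum_(i < l.+1) m, n.+1) :=
  \mxcol_(i < l.+1)
    (if i == 0%N :> nat then vandermonde n x else deriv_vandermonde n x i).

Definition bidiag_block (C : comNzRingType) (m l : nat) (x : 'rV[C]_m) :
  'M[C]_(\sum_(i < l.+1) m) :=
  \mxblock_(i < l.+1, j < l.+1)
    (if i == j then diag_mx x
     else if i == j.+1 :> nat then (i : nat)%:R *: (1%:M : 'M[C]_m)
     else (0 : 'M[C]_m)).

Definition stacked_e (C : comNzRingType) (m l : nat) :
  'cV[C]_(\sum_(i < l.+1) m) :=
  \mxcol_(i < l.+1)
    (if i == 0%N :> nat then const_mx 1 else (0 : 'cV[C]_m)).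

(* Main.v *)
(** Stack the values of all derivatives of a polynomial [p] at the points of
    [x] into one column.  The Leibniz rule
    (p X)^(i) = X p^(i) + i p^(i-1) says that the block bidiagonal matrix acts
    on such columns as multiplication of [p] by the variable, so its [k]-th
    power sends the column of [1] to the column of [X^k]. *)
Require Import Defs.
From HB Require Import structures.
From mathcomp Require Import all_boot all_order all_algebra.
From mathcomp Require Import reals complex.

Set Implicit Arguments.
Unset Strict Implicit.
Unset Printing Implicit Defensive.

Import GRing.Theory.
Local Open Scope ring_scope.
Local Open Scope complex_scope.

Definition jet_block (C : comNzRingType) (m : nat) (x : 'rV[C]_m)
    (p : {poly C}) (i : nat) : 'cV[C]_m :=
  \col_j (p^`(i)).[x 0 j].

Definition jet_col (C : comNzRingType) (m l : nat) (x : 'rV[C]_m)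
    (p : {poly C}) : 'cV[C]_(\sum_(i < l.+1) m) :=
  \mxcol_(i < l.+1) jet_block x p i.

(** Order zero is kept apart: the Leibniz rule has no lower-order term there, just as block row 0
    has no subdiagonal block. *)
Lemma jet_blockMX0 (C : comNzRingType) (m : nat) (x : 'rV[C]_m)
    (p : {poly C}) :
  jet_block x (p * 'X) 0 = diag_mx x *m jet_block x p 0.
Proof.
by apply/colP => j; rewrite mul_diag_mx !mxE !derivn0 hornerMX mulrC.
Qed.

Lemma jet_blockMXS (C : comNzRingType) (m : nat) (x : 'rV[C]_m)
    (p : {poly C}) (i : nat) :
  jet_block x (p * 'X) i.+1 =
    diag_mx x *m jet_block x p i.+1 + i.+1%:R *: jet_block x p i.
Proof.
apply/colP => j; rewrite mul_diag_mx !mxE.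
(* The Leibniz rule [derivnMXaddC] is stated for [p * 'X + c%:P]; take [c = 0]. *)
rewrite -[p * 'X]addr0 -polyC0 derivnMXaddC.
by rewrite hornerD hornerMn hornerMX -mulr_natl addrC [x 0 j * _]mulrC.
Qed.

Lemma bidiag_block_jet_col (C : comNzRingType) (m l : nat) (x : 'rV[C]_m)
    (p : {poly C}) :
  bidiag_block l x *m jet_col l x p = jet_col l x (p * 'X).
Proof.
rewrite /bidiag_block mxblockEv mxcol_mul; apply: eq_mxcol => i.
(* The diagonal block is split off first; in block row 0 every other block is zero. *)
rewrite mul_mxrow_mxcol (bigD1 i) //= eqxx.
case: i => -[|i] lt_il /=.
  rewrite jet_blockMX0 big1 ?addr0 // => j; rewrite eq_sym => /negPf ->.
  by rewrite mul0mx.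
(* Block row [i.+1] has one more block to extract, [i.+1] times the identity in block column [i]; it
   gives the second Leibniz term. *)
have lt_il' : (i < l.+1)%N by apply: ltnW.
rewrite jet_blockMXS (bigD1 (Ordinal lt_il')) /=; last first.
  by rewrite -val_eqE /= neq_ltn ltnSn.
rewrite -val_eqE /= (gtn_eqF (ltnSn i)) eqxx -scalemxAl mul1mx.
rewrite big1 ?addr0 // => j /andP[]; rewrite eq_sym => /negPf ->.
by rewrite -val_eqE /= eqSS eq_sym => /negPf ->; rewrite mul0mx.
Qed.

Lemma jet_col1 (C : comNzRingType) (m l : nat) (x : 'rV[C]_m) :
  jet_col l x 1 = stacked_e C m l.
Proof.
apply: eq_mxcol => -[[|i] lt_il] /=; apply/colP => j; rewrite !mxE.
  by rewrite derivn0 hornerC.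
by rewrite -polyC1 derivnC hornerC.
Qed.

Lemma jet_colXn (C : comNzRingType) (m l : nat) (x : 'rV[C]_m) (k : nat) :
  jet_col l x 'X^k = bidiag_block l x ^+ k *m stacked_e C m l.
Proof.
elim: k => [|k IHk]; first by rewrite !expr0 mul1mx jet_col1.
(* The new ['X] is split off on the right of the monomial, while the new matrix factor appears on
   the left of the power. *)
by rewrite exprSr -bidiag_block_jet_col IHk mulmxA mulmxE -exprS.
Qed.

Lemma col_stacked_vandermonde (C : comNzRingType) (m n l : nat)
    (x : 'rV[C]_m) (k : 'I_n.+1) :
  col k (stacked_vandermonde n l x) = jet_col l x 'X^k.
Proof.
rewrite col_mxcol; apply: eq_mxcol => -[[|i] lt_il] /=; apply/colP => j.
  (* The top block, defined by powers, is the derivative of order zero. *)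
  by rewrite !mxE derivn0 hornerXn.
by rewrite !mxE.
Qed.

Theorem theorem1 (R : realType) (m n l : nat) (hm : (1 <= m)%N)
    (hl : (1 <= l)%N) (x : 'rV[R[i]]_m) (k : 'I_n.+1) :
  col k (stacked_vandermonde n l x) =
    bidiag_block l x ^+ k *m stacked_e R[i] m l.
Proof. by rewrite col_stacked_vandermonde jet_colXn. Qed.
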